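(* Let $G$ be a finite-dimensional Lie group with Lie algebra $\mathfrak{g}$, let $\mathbb{I}$ be an inner product (kinetic energy tensor) on $\mathfrak{g}$, let $\nu_u:G\to\mathfrak{g}$ be a smooth kinematic control law (in the sense defined in the context), and let $\lambda>0$, $k_s>0$. Consider the fully-actuated, disturbance-free mechanical system on $TG\simeq G\times\mathfrak{g}$ with state $h(t)=(g(t),\nu(t))$, $$\dot g(t)=g(t)\cdot\nu(t),\qquad \dot\nu(t)+\overset{\mathfrak{g}}{\nabla}_{\nu(t)}\nu(t)=f_u,$$ let $s(h)=\nu+\lambda\nu_u(g)$ for $h=(g,\nu)$, and let $H=\{h\in TG\mid s(h)=0\}$. Then the reaching law $$f_u=\mathbb{I}^{\sharp}\big(\mathrm{ad}^*_{\lambda\nu_u(g)}\mathbb{I}^{\flat}(\nu(t))\big)-\lambda\dot\nu_u(g)-k_s\,s(h)$$ drives the trajectories of the closed-loop system exponentially to the sliding subgroup $H$ for all $h(0)\in TG$, i.e., $s(h(t))\to 0$ globally exponentially.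
   Context: $TG$ is identified with $G\times\mathfrak{g}$ by left translation: $(g,\nu)$ corresponds to $g\cdot\nu\triangleq T_eL_g(\nu)\in T_gG$, where $L_g(h)=gh$. $\mathbb{I}^{\flat}:\mathfrak{g}\to\mathfrak{g}^*$ is defined by $\langle\mathbb{I}^{\flat}(\xi);\zeta\rangle=\mathbb{I}(\zeta,\xi)$, and $\mathbb{I}^{\sharp}:\mathfrak{g}^*\to\mathfrak{g}$ is its inverse. $\mathrm{ad}_\xi\zeta=[\xi,\zeta]$, and $\mathrm{ad}^*_\xi:\mathfrak{g}^*\to\mathfrak{g}^*$ is defined by $\langle\mathrm{ad}^*_\xi\alpha;\zeta\rangle=\langle\alpha;[\xi,\zeta]\rangle$. The bilinear map $\overset{\mathfrak{g}}{\nabla}:\mathfrak{g}\times\mathfrak{g}\to\mathfrak{g}$ is $$\overset{\mathfrak{g}}{\nabla}_\xi\zeta\triangleq\tfrac12[\xi,\zeta]-\tfrac12\mathbb{I}^{\sharp}\big(\mathrm{ad}^*_\xi\mathbb{I}^{\flat}(\zeta)+\mathrm{ad}^*_\zeta\mathbb{I}^{\flat}(\xi)\big).$$ $\dot\nu_u(g)$ denotes the time derivative $\frac{d}{dt}\nu_u(g(t))$ along the trajectory. Let $V:G\to\mathbb{R}_{\ge 0}$ be an infinitely differentiable proper Morse function satisfying $V(g)>0$ for all $g\in G\setminus\{e\}$, and $\mathrm{d}V(g)=0$ and $V(g)=0\iff g=e$, where $e$ is the identity of $G$. Kinematic control law: a map $\nu_u:G\to\mathfrak{g}$ is a kinematic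 control law (relative to $V$) if, for the kinematics $\dot g(t)=g(t)\cdot\nu(t)$: (i) $\nu_u(e)=0$; (ii) $\nu_u(g^{-1})=-\nu_u(g)$ for all $g\in G$; (iii) $\langle \mathrm{d}V(g);\,-g\cdot\nu_u(g)\rangle<0$ for all $g\in G\setminus(\mathcal{O}_u\cup\{e\})$, where $\mathcal{O}_u\triangleq\{g\in G\setminus\{e\}\mid g\cdot\nu_u(g)=0\}$; (iv) $\langle \mathrm{d}V(g);\,-g\cdot\nu_u(g)\rangle=-y(g)V(g)$ for all $g\in\mathcal{U}$, where $y:\mathcal{U}\to\mathbb{R}_{>0}$ and $\mathcal{U}\subset G\setminus\mathcal{O}_u$ is a neighborhood of $e$. Here $\langle\cdot;\cdot\rangle$ denotes the pairing of a covector with a vector. *)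

(* Defs.v *)
From HB Require Import structures.
From mathcomp Require Import all_boot all_order all_algebra.
From mathcomp Require Import all_classical all_reals all_analysis.

Set Implicit Arguments.
Unset Strict Implicit.
Unset Printing Implicit Defensive.
Import Order.TTheory GRing.Theory Num.Theory.
Import numFieldNormedType.Exports.
Local Open Scope classical_set_scope.
Local Open Scope ring_scope.

(* Meaningful for open A: all derivatives are taken in the ambient space. *)
Fixpoint Ck_on (R : realType) (V W : normedModType R) (k : nat) (A : set V)
    (f : V -> W) : Prop :=
  match k with
  | 0 => forall x, A x -> {for x, continuous f}
  | k'.+1 => (forall x, A x -> differentiable f x) /\
             (forall v : V, Ck_on k' A (fun x => 'D_v f x))
  end.

Definition smooth_on (R : realType) (V W : normedModType R) (A : set V)
    (f : V -> W) : Prop :=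
  forall k, Ck_on k A f.

(* A homeomorphism between an open subset of T and an open subset of R^n; the
   total functions chart_fun and chart_inv are only relevant on these sets. *)
Record chart (R : realType) (n : nat) (T : topologicalType) := Chart {
  chart_dom : set T;
  chart_cod : set 'rV[R]_n;
  chart_fun :> T -> 'rV[R]_n;
  chart_inv : 'rV[R]_n -> T;
  chart_dom_open : open chart_dom;
  chart_cod_open : open chart_cod;
  chart_fun_cod : forall x, chart_dom x -> chart_cod (chart_fun x);
  chart_inv_dom : forall u, chart_cod u -> chart_dom (chart_inv u);
  chart_funK : forall x, chart_dom x -> chart_inv (chart_fun x) = x;
  chart_invK : forall u, chart_cod u -> chart_fun (chart_inv u) = u;
  chart_fun_cts : forall x, chart_dom x -> {for x, continuous chart_fun};
  chart_inv_cts : forall u, chart_cod u -> {for u, continuous chart_inv}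
}.

(* The atlas is indexed by the points of the manifold, chart_at x being a chart
   around x. Every smooth structure is generated by such an atlas. *)
HB.mixin Record isSmoothManifold (R : realType) (n : nat) T of Topological T := {
  chart_at : T -> chart R n T;
  chart_at_dom : forall x, chart_dom (chart_at x) x;
  chart_transition : forall x y,
    smooth_on [set u | chart_cod (chart_at x) u /\
                       chart_dom (chart_at y) (chart_inv (chart_at x) u)]
              (fun u => chart_at y (chart_inv (chart_at x) u));
  manifold_hausdorff : hausdorff_space T;
  manifold_second_countable : @second_countable T
}.

#[short(type="smoothManifoldType")]
HB.structure Definition SmoothManifold (R : realType) (n : nat) :=
  {T of Topological T & isSmoothManifold R n T}.

HB.mixin Record isLieGroup (R : realType) (n : nat) G
    of SmoothManifold R n G & Group G := {
  lie_mul_cts : continuous (fun p : G * G => (p.1 * p.2)%g);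
  lie_mul_smooth : forall a b c : G,
    let psi x := chart_inv (chart_at x) in
    smooth_on [set p : 'rV[R]_n * 'rV[R]_n |
                 [/\ chart_cod (chart_at a) p.1, chart_cod (chart_at b) p.2 &
                     chart_dom (chart_at c) (psi a p.1 * psi b p.2)%g]]
              (fun p => chart_at c (psi a p.1 * psi b p.2)%g);
  lie_inv_cts : continuous (fun x : G => (x^-1)%g);
  lie_inv_smooth : forall a b : G,
    let psi x := chart_inv (chart_at x) in
    smooth_on [set u : 'rV[R]_n |
                 chart_cod (chart_at a) u /\
                 chart_dom (chart_at b) (psi a u)^-1%g]
              (fun u => chart_at b (psi a u)^-1%g)
}.

#[short(type="lieGroupType")]
HB.structure Definition LieGroup (R : realType) (n : nat) :=
  {G of SmoothManifold R n G & Group G & isLieGroup R n G}.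

(* The tangent space at x is 'rV[R]_n: a tangent vector is given by its
   components in the chart chart_at x. *)
Section Tangent.
Context {R : realType} {n : nat} {M : smoothManifoldType R n}.

Definition smooth (W : normedModType R) (f : M -> W) : Prop :=
  forall x, smooth_on (chart_cod (chart_at x)) (f \o chart_inv (chart_at x)).

(* <df(x); v> *)
Definition mdiff (W : normedModType R) (f : M -> W) (x : M) (v : 'rV[R]_n) : W :=
  'd (f \o chart_inv (chart_at x)) (chart_at x x) v.

(* T_x F : T_x M -> T_{F x} M *)
Definition tangent_map (F : M -> M) (x : M) (v : 'rV[R]_n) : 'rV[R]_n :=
  mdiff (chart_at (F x) \o F) x v.

Definition has_velocity (c : R -> M) (t : R) (v : 'rV[R]_n) : Prop :=
  {for t, continuous c} /\ is_derive t 1 (chart_at (c t) \o c) v.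

Definition critical_point (f : M -> R) (x : M) : Prop :=
  forall v, mdiff f x v = 0.

(* Second derivative in the chart at x; chart-independent when x is critical. *)
Definition hessian (f : M -> R) (x : M) (u v : 'rV[R]_n) : R :=
  'D_u (fun y => 'D_v (f \o chart_inv (chart_at x)) y) (chart_at x x).

Definition morse (f : M -> R) : Prop :=
  smooth f /\
  forall x, critical_point f x ->
    forall u, (forall v, hessian f x u v = 0) -> u = 0.

Definition proper_fun (f : M -> R) : Prop :=
  forall K : set R, compact K -> compact (f @^-1` K).

End Tangent.

(* The Lie algebra is the tangent space at the identity, i.e. 'rV[R]_n in the
   components of the chart at the identity. *)
Section LieAlgebra.
Context {R : realType} {n : nat} {G : lieGroupType R n}.

(* g . nu *)
Definition ltrans (g : G) (nu : 'rV[R]_n) : 'rV[R]_n :=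
  tangent_map (fun h : G => (g * h)%g) 1%g nu.

(* Principal part, in the chart at the identity, of the left-invariant vector
   field g |-> g . xi. Unlike ltrans g xi, its value at the point g with
   coordinates u is read in the chart at the identity, not in chart_at g. *)
Definition left_invariant_field (xi u : 'rV[R]_n) : 'rV[R]_n :=
  let e : G := 1%g in
  mdiff (fun h : G => chart_at e (chart_inv (chart_at e) u * h)%g) e xi.

Definition vf_bracket (X Y : 'rV[R]_n -> 'rV[R]_n) (u : 'rV[R]_n) : 'rV[R]_n :=
  'd Y u (X u) - 'd X u (Y u).

Definition bracket (xi zeta : 'rV[R]_n) : 'rV[R]_n :=
  vf_bracket (left_invariant_field xi) (left_invariant_field zeta)
    (chart_at (1%g : G) 1%g).

Local Notation dual := 'Hom('rV[R]_n, R^o).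

Definition ad_star (xi : 'rV[R]_n) (alpha : dual) : dual :=
  linfun (fun zeta => alpha (bracket xi zeta) : R^o).

Definition flat (II : {dot 'rV[R]_n for @idfun R}) : 'Hom('rV[R]_n, dual) :=
  linfun (fun xi => linfun (fun zeta => II zeta xi : R^o) : dual).

Definition sharp (II : {dot 'rV[R]_n for @idfun R}) : 'Hom(dual, 'rV[R]_n) :=
  ((flat II)^-1)%VF.

Definition connection (II : {dot 'rV[R]_n for @idfun R}) (xi zeta : 'rV[R]_n) :
    'rV[R]_n :=
  2^-1 *: bracket xi zeta
  - 2^-1 *: sharp II (ad_star xi (flat II zeta) + ad_star zeta (flat II xi)).

Definition lyapunov_potential (V : G -> R) : Prop :=
  [/\ morse V /\ proper_fun V,
      forall g, 0 <= V g,
      forall g, g <> 1%g -> 0 < V g &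
      forall g, (critical_point V g /\ V g = 0) <-> g = 1%g].

Definition kcl_zeros (nu_u : G -> 'rV[R]_n) : set G :=
  [set g | g <> 1%g /\ ltrans g (nu_u g) = 0].

Definition kinematic_control_law (V : G -> R) (nu_u : G -> 'rV[R]_n) : Prop :=
  [/\ nu_u 1%g = 0,
      forall g, nu_u g^-1%g = - nu_u g,
      forall g, ~ kcl_zeros nu_u g -> g <> 1%g ->
        mdiff V g (- ltrans g (nu_u g)) < 0 &
      exists (U : set G) (y : G -> R),
        [/\ nbhs (1%g : G) U, U `<=` ~` kcl_zeros nu_u,
            forall g, U g -> 0 < y g &
            forall g, U g -> mdiff V g (- ltrans g (nu_u g)) = - y g * V g]].

(* h is a solution on [0, T[ of the mechanical system with forcing t |-> f t:
   continuous on [0, T[, and satisfying the equations on ]0, T[. *)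
Definition mechanical_trajectory (II : {dot 'rV[R]_n for @idfun R})
    (f : R -> 'rV[R]_n) (T : \bar R) (h : R -> G * 'rV[R]_n) : Prop :=
  {within [set t : R | 0 <= t /\ (t%:E < T)%E], continuous h} /\
  forall t : R, 0 < t -> (t%:E < T)%E ->
    [/\ has_velocity (fun r => (h r).1) t (ltrans (h t).1 (h t).2),
        derivable (fun r => (h r).2) t 1 &
        derive1 (fun r => (h r).2) t + connection II (h t).2 (h t).2 = f t].

Definition sliding (nu_u : G -> 'rV[R]_n) (lambda : R) (h : G * 'rV[R]_n) :
    'rV[R]_n :=
  h.2 + lambda *: nu_u h.1.

(* The value at time t of the feedback along h. *)
Definition reaching_law (II : {dot 'rV[R]_n for @idfun R})
    (nu_u : G -> 'rV[R]_n) (lambda k_s : R) (h : R -> G * 'rV[R]_n) (t : R) :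
    'rV[R]_n :=
  sharp II (ad_star (lambda *: nu_u (h t).1) (flat II (h t).2))
  - lambda *: derive1 (fun r => nu_u (h r).1) t
  - k_s *: sliding nu_u lambda (h t).

End LieAlgebra.

Definition dot_norm (R : realType) (n : nat) (II : {dot 'rV[R]_n for @idfun R})
    (v : 'rV[R]_n) : R :=
  Num.sqrt (II v v).

(* Main.v *)
Require Import Defs.
From HB Require Import structures.
From mathcomp Require Import all_boot all_order all_algebra.
From mathcomp Require Import all_classical all_reals all_analysis.
From mathcomp Require Import ring lra.
Import Order.TTheory GRing.Theory Num.Theory.
Import numFieldNormedType.Exports.
Local Open Scope classical_set_scope.
Local Open Scope ring_scope.

(** Write s = nu + lambda nu_u(g) and F(xi) = I^sharp (ad^*_xi I^flat nu).
    As [nu, nu] = 0, the connection term of the system is -F(nu), and inserting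
    the reaching law gives
      ds/dt = F(nu) + F(lambda nu_u) - k_s s.
    The pairing of F(xi) with a vector zeta is I([xi, zeta], nu), so the two
    gyroscopic terms contribute I([nu + lambda nu_u, s], nu) = I([s, s], nu) = 0
    to the power I(ds/dt, s): the feedback force has been chosen exactly so that
    together they do no work on s. Hence
      d/dt I(s, s) = - 2 k_s I(s, s),
    so that |s(t)| = exp(- k_s t) |s(0)| as an equality, for the norm of I. The
    constants C = 1 and k = k_s follow ([dot_sliding_decay]).

    Most of the work is in the ingredients of this computation. Bilinearity of
    the bracket ([bracket_linearl]) is not formal: the bracket is defined from
    the derivatives of left-invariant fields in a chart, and these fields have
    first to be shown differentiable at the identity, which is where the group
    law being twice differentiable enters. That I^sharp inverts I^flat
    ([sharpK]) is a dimension count. The time derivative of nu_u(g(t)) exists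
    because nu_u is smooth in charts and g has a velocity
    ([smooth_derivable_along]). Convergence in the topology of R^n follows from
    that in the norm of I, since by Cauchy-Schwarz each coordinate is bounded by
    that norm ([cvg_dot_norm0]). *)

(** * Inner products and the musical isomorphisms *)

Lemma linfun_linearE {K : fieldType} {U W : vectType K} (f : U -> W) :
  linear f -> linfun f =1 f.
Proof.
move=> lf u.
pose L : {linear U -> W} := HB.pack f (GRing.isLinear.Build _ _ _ _ f lf).
by rewrite -[f]/(L : _ -> _) lfunE.
Qed.

Section InnerProduct.
Context {R : realType} {n : nat} (II : {dot 'rV[R]_n for @idfun R}).

Lemma dotC u v : II u v = II v u.
Proof. by rewrite hermC expr0 mul1r. Qed.

Lemma dot_linearl w a u v : II (a *: u + v) w = a * II u w + II v w.
Proof. by rewrite linearPl. Qed.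

Lemma dotZl w a u : II (a *: u) w = a * II u w.
Proof. exact: (linearZl_LR II). Qed.

Lemma dotDl w u v : II (u + v) w = II u w + II v w.
Proof. exact: (linearDl II). Qed.

Lemma dotNl w u : II (- u) w = - II u w.
Proof. exact: (linearNl II). Qed.

Lemma dot_ge0 u : 0 <= II u u.
Proof.
have [->|u0] := eqVneq u 0; first by rewrite linear0l.
exact/ltW/neq0_dnorm_gt0.
Qed.

Lemma flatE xi zeta : flat II xi zeta = II zeta xi.
Proof.
rewrite linfun_linearE => [|a u v].
  by rewrite linfun_linearE // => a u v; rewrite dot_linearl.
apply/lfunP => w; rewrite add_lfunE scale_lfunE.
by rewrite !linfun_linearE //= ?[II w _]dotC ?dot_linearl ?[II w _]dotC//;
  move=> b x y; rewrite dot_linearl.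
Qed.

(** [flat II] is injective by definiteness, hence surjective because a space
    and its dual have the same dimension; so its partial inverse [sharp II] is
    a right inverse on all of the dual. *)
Lemma sharpK alpha zeta : II zeta (sharp II alpha) = alpha zeta.
Proof.
rewrite -flatE limg_lfunVK //.
suff -> : limg (flat II) = fullv by rewrite memvf.
have ker0 : lker (flat II) = 0%VS.
  apply/eqP; rewrite -subv0; apply/subvP => u.
  rewrite memv_ker memv0 => /eqP u0.
  apply: contraT => /(neq0_dnorm_gt0 (s := II)).
  by rewrite -flatE u0 lfunE ltxx.
apply/eqP; rewrite eqEdim subvf /=.
rewrite limg_dim_eq ?ker0 ?capv0 // !dimvf.
by rewrite !/vector.dim /= muln1.
Qed.

Lemma dot_coords u v : II u v = \sum_i \sum_j u 0 i * v 0 j * II 'e_i 'e_j.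
Proof.
rewrite {1}[u]row_sum_delta linear_sumlz; apply: eq_bigr => i _.
rewrite linearZl_LR {1}[v]row_sum_delta linear_sumr mulr_sumr.
by apply: eq_bigr => j _; rewrite linearZr_LR /= mulrA.
Qed.

Lemma is_derive_dot (s : R -> 'rV[R]_n) (t : R) ds :
  is_derive t 1 s ds ->
  is_derive t 1 (fun r => II (s r) (s r)) (2 * II ds (s t)).
Proof.
move=> [sd sE].
have di i : is_derive t 1 (fun r => s r 0 i) (ds 0 i).
  apply: DeriveDef; first by move/derivable_mxP : sd; apply.
  by rewrite -sE derive_mx // mxE.
have -> : (fun r => II (s r) (s r)) =
    \sum_i \sum_j II 'e_i 'e_j \*: ((fun r => s r 0 i) * (fun r => s r 0 j)).
  apply/funext => r; rewrite dot_coords fct_sumE; apply: eq_bigr => i _.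
  by rewrite fct_sumE; apply: eq_bigr => j _; rewrite mulrC.
have H := is_derive_sum (fun i => is_derive_sum (fun j =>
  is_deriveZ (II 'e_i 'e_j) (is_deriveM (di i) (di j)))).
apply: is_derive_eq.
rewrite mulr_natl mulr2n {1}dotC !dot_coords -big_split.
apply: eq_bigr => i _ /=; rewrite -big_split.
by apply: eq_bigr => j _ /=; rewrite /GRing.scale /=; ring.
Qed.

Lemma dot_continuous : continuous (fun v => II v v).
Proof.
move=> v.
have dd i j : differentiable
    (II 'e_i 'e_j \*: ((fun v : 'rV[R]_n => v 0 i : R) * (fun v => v 0 j : R)))
    v.
  apply: differentiableZ; apply: differentiableM; exact: differentiable_coord.
have := differentiable_sum (fun i => differentiable_sum (dd i)).
move=> /differentiable_continuous; congr (continuous_at v _).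
apply/funext => u; rewrite dot_coords fct_sumE; apply: eq_bigr => i _.
rewrite fct_sumE; apply: eq_bigr => j _; exact: mulrC.
Qed.

Lemma dot_CauchySchwarz u v : `|II u v| <= dot_norm II u * dot_norm II v.
Proof.
rewrite -sqrtrM ?dot_ge0 // -sqrtr_sqr ler_sqrt ?mulr_ge0 ?dot_ge0 //.
have [->|v0] := eqVneq v 0; first by rewrite !linear0r expr0n.
have vv : 0 < II v v by exact: neq0_dnorm_gt0.
have sq a b : II (a *: u + b *: v) (a *: u + b *: v) =
    a * (a * II u u + b * II u v) + b * (a * II u v + b * II v v).
  rewrite dot_linearl dotZl [II u _]dotC [II v _]dotC !dot_linearl.
  by rewrite !dotZl [II v u]dotC.
(* Up to the factor II v v, this vector is the component of u orthogonal to
   v. *)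
have := dot_ge0 (II v v *: u + (- II u v) *: v).
rewrite sq => h.
have : 0 <= II v v * (II u u * II v v - II u v ^+ 2) by move: h; lra.
by rewrite pmulr_rge0 // subr_ge0.
Qed.

(** Each coordinate is a linear form, hence the inner product with a fixed
    vector, hence controlled by the norm of the inner product. *)
Lemma cvg_dot_norm0 (s : R -> 'rV[R]_n) (F : set_system R) {FF : Filter F} :
  dot_norm II (s t) @[t --> F] --> (0 : R) -> s t @[t --> F] --> (0 : 'rV[R]_n).
Proof.
move=> s0.
have coord0 i : s t 0 i @[t --> F] --> (0 : R).
  pose a := sharp II (linfun (fun u : 'rV[R]_n => u 0 i : R^o)).
  have aE (u : 'rV[R]_n) : u 0 i = II u a.
    by rewrite sharpK linfun_linearE // => b x y; rewrite !mxE.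
  apply/norm_cvg0P.
  apply: (@squeeze_cvgr _ F _ _ (cst 0)
    (fun t => dot_norm II (s t) * dot_norm II a)).
  - by apply: nearW => t; rewrite normr_ge0 /= aE dot_CauchySchwarz.
  - exact: cvg_cst.
  - by rewrite -[X in _ --> X](mul0r (dot_norm II a)); apply: cvgMr_tmp.
apply/cvg_ballP => e e0.
have : \forall t \near F, forall i, ball (0 : R) e (s t 0 i).
  by apply: filter_forall => i; move/cvg_ballP: (coord0 i); exact.
by apply: filterS => t ht; split => // i j; rewrite ord1 mxE; exact: ht.
Qed.

End InnerProduct.

(** * Differentiability in charts *)

Lemma near_eq_differentiable {K : numFieldType} {V W : normedModType K}
    (f g : V -> W) (x : V) :
  (\near x, f x = g x) -> differentiable f x -> differentiable g x.
Proof.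
move=> fg df.
have eqo : g \o shift x = cst (g x) + 'd f x +o_0 id.
  rewrite -(nbhs_singleton fg); apply/eqaddoP => e e0.
  move/eqaddoP: (diff_locally df) => /(_ e e0).
  have: \forall h \near (0 : V), f (h + x) = g (h + x).
    by move: fg; rewrite (near_shift 0) subr0.
  apply: filterS2 => h /= fgh.
  by rewrite /= !fctE /= fgh.
have dgf : 'd g x = 'd f x :> (V -> W).
  exact: (diff_unique (diff_continuous df) eqo).
by apply/diff_locallyP; rewrite dgf; split => //; exact: diff_continuous.
Qed.

Lemma smooth_on_differentiable {K : realType} {V W : normedModType K}
    (A : set V) (f : V -> W) (x : V) :
  smooth_on A f -> A x -> differentiable f x.
Proof. by move=> /(_ 1%N)[df _]; exact: df. Qed.

Lemma smooth_on_derive_differentiable {K : realType} {V W : normedModType K}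
    (A : set V) (f : V -> W) (v x : V) :
  smooth_on A f -> A x -> differentiable ('D_v f) x.
Proof. by move=> /(_ 2)[_ /(_ v)[df _]]; exact: df. Qed.

Lemma diff_pairr {K : numFieldType} {U V W : normedModType K}
    (f : U * V -> W) (u : U) (v w : V) :
  differentiable f (u, v) ->
  'd (fun v' => f (u, v')) v w = 'D_((0, w) : U * V) f (u, v).
Proof.
move=> df.
have dp : differentiable (fun v' : V => (u, v')) v by exact: differentiable_pair.
rewrite (_ : (fun v' => f (u, v')) = f \o (fun v' => (u, v'))) //.
by rewrite diff_comp //= deriveE // diff_pair // diff_cst diff_val.
Qed.

Lemma mdiff_linear {K : realType} {m : nat} {M : smoothManifoldType K m}
    {W : normedModType K} (f : M -> W) (x : M) a u v :
  mdiff f x (a *: u + v) = a *: mdiff f x u + mdiff f x v.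
Proof. exact: linearP. Qed.

Section SmoothMaps.
Context {R : realType} {n : nat} {M : smoothManifoldType R n}.
Context {W : normedModType R}.

Lemma near_chart_funK (x : M) :
  \forall y \near x, chart_inv (chart_at x) (chart_at x y) = y.
Proof.
have : \forall y \near x, chart_dom (chart_at x) y.
  by apply: open_nbhs_nbhs; split; [exact: chart_dom_open|exact: chart_at_dom].
by apply: filterS => y; exact: chart_funK.
Qed.

Lemma smooth_chart_differentiable (f : M -> W) (x : M) :
  smooth f -> differentiable (f \o chart_inv (chart_at x)) (chart_at x x).
Proof.
move=> /(_ x) fs; apply: (smooth_on_differentiable _ _ _ fs).
exact/chart_fun_cod/chart_at_dom.
Qed.

Lemma smooth_continuous (f : M -> W) : smooth f -> continuous f.
Proof.
move=> fs x.
have cf : {for x, continuous ((f \o chart_inv (chart_at x)) \o chart_at x)}.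
  apply: continuous_comp; first exact/chart_fun_cts/chart_at_dom.
  exact/differentiable_continuous/smooth_chart_differentiable.
suff : f y @[y --> x] --> ((f \o chart_inv (chart_at x)) \o chart_at x) x.
  by rewrite /= chart_funK //; exact: chart_at_dom.
apply: cvg_trans cf; apply: near_eq_cvg.
by apply: filterS (near_chart_funK x) => y /= ->.
Qed.

(** The curve is continuous, so near t it stays in the domain of the chart at
    c(t), where f \o c is the chart expression of f after that of c. *)
Lemma smooth_derivable_along (f : M -> W) (c : R -> M) (t : R) v :
  smooth f -> has_velocity c t v -> derivable (fun r => f (c r)) t 1.
Proof.
move=> fs [cc [cd _]]; apply/derivable1_diffP.
apply: (near_eq_differentiable
  ((f \o chart_inv (chart_at (c t))) \o (chart_at (c t) \o c))).
  have : \forall r \near t,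
      chart_inv (chart_at (c t)) (chart_at (c t) (c r)) = c r.
    exact: cc (near_chart_funK (c t)).
  by apply: filterS => r /= ->.
apply: differentiable_comp; first exact/derivable1_diffP.
exact: smooth_chart_differentiable.
Qed.

End SmoothMaps.

(** * The Lie bracket *)

Lemma vf_bracket_linearl {K : realType} {m : nat} a
    (X Y Z : 'rV[K]_m -> 'rV[K]_m) (u : 'rV[K]_m) :
  differentiable X u -> differentiable Y u ->
  vf_bracket (a *: X + Y) Z u = a *: vf_bracket X Z u + vf_bracket Y Z u.
Proof.
move=> dX dY; rewrite /vf_bracket.
have dZ := differentiableZ a dX.
have D := diffD dZ dY.
have D' := diffZ a dX.
transitivity ((a *: 'd Z u (X u) + 'd Z u (Y u))
              - (a *: 'd X u (Z u) + 'd Y u (Z u))).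
  apply: f_equal2; first exact: linearP.
  apply: f_equal.
  exact: etrans (congr1 (@^~ (Z u)) D) (congr1 (fun f => f (Z u) + _) D').
by rewrite opprD addrACA scalerBr.
Qed.

Section LieBracket.
Context {R : realType} {n : nat} {G : lieGroupType R n}.
Local Notation e := (1%g : G).
Local Notation bracket := (@bracket R n G).
Local Notation left_invariant_field := (@left_invariant_field R n G).

Lemma bracketC xi zeta : bracket xi zeta = - bracket zeta xi.
Proof. by rewrite /Defs.bracket /vf_bracket opprB. Qed.

Lemma bracket_self xi : bracket xi xi = 0.
Proof. exact: subrr. Qed.

Lemma left_invariant_field_linear a xi zeta :
  left_invariant_field (a *: xi + zeta) =
  a *: left_invariant_field xi + left_invariant_field zeta.
Proof. by apply/funext => u; exact: mdiff_linear. Qed.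

(** In the chart at the identity, the field is the partial derivative of the
    multiplication in its second argument, in direction xi, restricted to the
    slice where that argument is the identity; so it is differentiable because
    the multiplication is twice differentiable. *)
Lemma left_invariant_field_differentiable xi :
  differentiable (left_invariant_field xi) (chart_at e e).
Proof.
have S := lie_mul_smooth e e e.
move: S; cbv zeta.
set A := (X in smooth_on X _).
set F := (X in smooth_on _ X).
move=> S.
have dom u : chart_cod (chart_at e) u -> A (u, chart_at e e).
  move=> ucod; split => /=.
  - exact: ucod.
  - exact/chart_fun_cod/chart_at_dom.
  - rewrite chart_funK; last exact: chart_at_dom.
    by rewrite mulg1; exact: chart_inv_dom.
have Fu u : chart_cod (chart_at e) u -> differentiable F (u, chart_at e e).
  by move=> ?; apply: (smooth_on_differentiable _ _ _ S); exact: dom.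
have u0cod : chart_cod (chart_at e) (chart_at e e).
  exact/chart_fun_cod/chart_at_dom.
have pairl : differentiable (fun u : 'rV[R]_n => (u, chart_at e e))
    (chart_at e e).
  exact: differentiable_pair.
apply: (near_eq_differentiable
  (fun u => 'D_((0, xi) : 'rV[R]_n * 'rV[R]_n) F (u, chart_at e e))); last first.
  apply: (@differentiable_comp _ _ _ _ (fun u => (u, chart_at e e))
    ('D_((0, xi) : 'rV[R]_n * 'rV[R]_n) F)) => //.
  by apply: (smooth_on_derive_differentiable _ _ _ _ S); exact: dom.
have : \forall u \near chart_at e e, chart_cod (chart_at e) u.
  by apply: open_nbhs_nbhs; split => //; exact: chart_cod_open.
apply: filterS => u ucod.
by rewrite -diff_pairr //; exact: Fu.
Qed.

Lemma bracket_linearl a xi eta zeta :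
  bracket (a *: xi + eta) zeta = a *: bracket xi zeta + bracket eta zeta.
Proof.
rewrite /Defs.bracket left_invariant_field_linear.
by apply: vf_bracket_linearl; exact: left_invariant_field_differentiable.
Qed.

Lemma bracketDl xi eta zeta :
  bracket (xi + eta) zeta = bracket xi zeta + bracket eta zeta.
Proof. by have := bracket_linearl 1 xi eta zeta; rewrite !scale1r. Qed.

Lemma bracket_linearr a xi eta zeta :
  bracket zeta (a *: xi + eta) = a *: bracket zeta xi + bracket zeta eta.
Proof. by rewrite !(bracketC zeta) bracket_linearl opprD scalerN. Qed.

Lemma ad_starE xi alpha zeta :
  ad_star (G := G) xi alpha zeta = alpha (bracket xi zeta).
Proof.
by rewrite linfun_linearE // => a u v; rewrite bracket_linearr (linearP alpha).
Qed.

End LieBracket.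

(** * The closed loop *)

Section ClosedLoop.
Context {R : realType} {n : nat} {G : lieGroupType R n}.
Context (II : {dot 'rV[R]_n for @idfun R}).
Local Notation bracket := (@bracket R n G).

Definition coadjoint_force (xi nu : 'rV[R]_n) : 'rV[R]_n :=
  sharp II (ad_star (G := G) xi (flat II nu)).

Lemma dot_coadjoint_force xi nu zeta :
  II (coadjoint_force xi nu) zeta = II (bracket xi zeta) nu.
Proof. by rewrite dotC sharpK ad_starE flatE. Qed.

Lemma connection_self nu :
  connection (G := G) II nu nu = - coadjoint_force nu nu.
Proof.
rewrite /connection bracket_self scaler0 sub0r linearD scalerDr -scalerDl.
by rewrite (_ : 2^-1 + 2^-1 = 1 :> R) ?scale1r //; lra.
Qed.

(** The power of the two forces on nu + u is the inner product of
    [nu + u, nu + u] with nu. This is why the first term of the reaching law has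
    the form it has. *)
Lemma dot_coadjoint_force_sum0 nu u :
  II (coadjoint_force nu nu + coadjoint_force u nu) (nu + u) = 0.
Proof.
rewrite dotDl.
transitivity (II (bracket nu (nu + u)) nu + II (bracket u (nu + u)) nu).
  by apply: f_equal2; exact: dot_coadjoint_force.
rewrite -(dotDl II nu (bracket nu (nu + u))) -bracketDl bracket_self.
exact: (linear0l II).
Qed.

Context {nu_u : G -> 'rV[R]_n} {lambda k_s : R} (nu_u_smooth : smooth nu_u).
Context {T : \bar R} {h : R -> G * 'rV[R]_n}.
Context (traj :
  mechanical_trajectory II (reaching_law II nu_u lambda k_s h) T h).
Local Notation s := (fun t => sliding nu_u lambda (h t)).

Lemma sliding_is_derive (t : R) : 0 < t -> (t%:E < T)%E ->
  is_derive t 1 s (coadjoint_force (h t).2 (h t).2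
     + coadjoint_force (lambda *: nu_u (h t).1) (h t).2 - k_s *: s t).
Proof.
have cancel (a b c d : 'rV[R]_n) : b - c - d + a + c = a + b - d.
  by rewrite [LHS]addrAC [b - c - d]addrAC subrK addrAC [a + b]addrC.
move=> t0 tT; have [_ /(_ t t0 tT)[vel nud eqn]] := traj.
have und := smooth_derivable_along _ _ _ _ nu_u_smooth vel.
have : is_derive t 1 s ('D_1 (fun r => (h r).2) t
    + lambda *: 'D_1 (fun r => nu_u (h r).1) t).
  exact: is_deriveD (derivableP nud) (is_deriveZ lambda (derivableP und)).
move=> /is_derive_eq; apply.
move: eqn; rewrite connection_self /reaching_law !derive1E => /eqP.
rewrite subr_eq => /eqP ->.
exact: cancel.
Qed.

Lemma dot_sliding_derive (t : R) : 0 < t -> (t%:E < T)%E ->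
  is_derive t 1 (fun r => II (s r) (s r)) (- (2 * k_s) * II (s t) (s t)).
Proof.
move=> t0 tT; apply: is_derive_eq.
  exact: is_derive_dot (sliding_is_derive t t0 tT).
rewrite dotDl dotNl dotZl dot_coadjoint_force_sum0 add0r.
by rewrite mulrN mulNr mulrA.
Qed.

Lemma sliding_within_continuous (t : R) : (t%:E < T)%E ->
  {within `[0, t], continuous s}.
Proof.
move=> tT; have [hc _] := traj.
have sub : `[0, t]%classic `<=` [set t : R | 0 <= t /\ (t%:E < T)%E].
  move=> r /=; rewrite in_itv /= => /andP[r0 rt]; split => //.
  by apply: le_lt_trans tT; rewrite lee_fin.
apply: (within_continuous_comp _ h (sliding nu_u lambda)); last first.
  exact: continuous_subspaceW hc.
move=> p _; apply: cvgD; first exact: cvg_snd.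
apply: cvgZl_tmp.
by apply: continuous_comp; [exact: cvg_fst|exact: smooth_continuous].
Qed.

(** The product of exp(2 k_s t) with the squared norm of s has derivative zero
    on ]0, T[ and is continuous up to 0, so it is constant by the mean value
    theorem. *)
Lemma dot_sliding_decay (t : R) : 0 <= t -> (t%:E < T)%E ->
  II (s t) (s t) = expR (- (2 * k_s) * t) * II (s 0) (s 0).
Proof.
rewrite le_eqVlt => /orP[/eqP<- _|t0 tT]; first by rewrite mulr0 expR0 mul1r.
pose E r := expR (2 * k_s * r) * II (s r) (s r).
have dE r : r \in `]0, t[ -> is_derive r 1 E 0.
  rewrite in_itv /= => /andP[r0 rt].
  have dexp : is_derive r 1 (fun r => expR (2 * k_s * r))
      (2 * k_s * expR (2 * k_s * r)).
    have dlin : is_derive r 1 (fun r => 2 * k_s * r) (2 * k_s).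
      have := is_deriveZ (2 * k_s) (is_derive_id r (1 : R)).
      by move=> /is_derive_eq; apply; rewrite /GRing.scale /= mulr1.
    rewrite [_ * expR _]mulrC.
    exact: is_derive1_comp (is_derive_expR (2 * k_s * r)) dlin.
  have rT : (r%:E < T)%E by apply: lt_trans tT; rewrite lte_fin.
  have dW := dot_sliding_derive r r0 rT.
  have := is_deriveM dexp dW; move=> /is_derive_eq; apply.
  rewrite /GRing.scale /=; ring.
have cE : {within `[0, t], continuous E}.
  move=> r; apply: cvgM.
    apply: (continuous_subspaceT (f := fun r => expR (2 * k_s * r))) => {}r.
    by apply: continuous_comp; [exact: cvgMl_tmp cvg_id|exact: continuous_expR].
  apply: (within_continuous_comp _ s (fun v => II v v)).
    by move=> v _; exact: dot_continuous.
  exact: sliding_within_continuous.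
have [c _] := MVT t0 dE cE.
rewrite mul0r => /eqP; rewrite subr_eq0 => /eqP.
rewrite /E mulr0 expR0 mul1r => <-.
by rewrite mulrA -expRD mulNr addNr expR0 mul1r.
Qed.

End ClosedLoop.

Theorem theorem6 (R : realType) (n : nat) (G : lieGroupType R n)
    (II : {dot 'rV[R]_n for @idfun R}) (V : G -> R) (nu_u : G -> 'rV[R]_n)
    (lambda k_s : R) :
  lyapunov_potential V ->
  kinematic_control_law V nu_u ->
  smooth nu_u ->
  0 < lambda -> 0 < k_s ->
  exists C k : R, [/\ 0 < C, 0 < k &
    forall (T : \bar R) (h : R -> G * 'rV[R]_n),
      (0 < T)%E ->
      mechanical_trajectory II (reaching_law II nu_u lambda k_s h) T h ->
      (forall t : R, 0 <= t -> (t%:E < T)%E ->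
         dot_norm II (sliding nu_u lambda (h t))
           <= C * expR (- k * t) * dot_norm II (sliding nu_u lambda (h 0))) /\
      (T = +oo%E -> sliding nu_u lambda (h t) @[t --> +oo] --> (0 : 'rV[R]_n))].
Proof.
move=> _ _ nu_smooth _ k0.
exists 1, k_s; split => // T h _ traj.
have decay (t : R) : 0 <= t -> (t%:E < T)%E ->
    dot_norm II (sliding nu_u lambda (h t)) =
    expR (- k_s * t) * dot_norm II (sliding nu_u lambda (h 0)).
  move=> t0 tT; rewrite /dot_norm (dot_sliding_decay _ nu_smooth traj) //.
  rewrite sqrtrM ?expR_ge0 //; congr (_ * _).
  rewrite (_ : - (2 * k_s) * t = (- k_s * t) *+ 2); last by rewrite mulr2n; ring.
  by rewrite mulr2n expRD -expr2 sqrtr_sqr ger0_norm // expR_ge0.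
split=> [t t0 tT|Too]; first by rewrite decay // mul1r.
apply: (cvg_dot_norm0 II).
have : expR (- k_s * t) * dot_norm II (sliding nu_u lambda (h 0)) @[t --> +oo] --> (0 : R).
  rewrite -[X in _ --> X](mul0r (dot_norm II (sliding nu_u lambda (h 0)))).
  apply: cvgMr_tmp.
  have kinfty : k_s * t @[t --> +oo] --> +oo by exact: gt0_cvgMry k0 cvg_id.
  rewrite (_ : (fun t => _) = (fun x => expR (- x)) \o (fun t => k_s * t)).
    exact: (cvg_comp _ (fun x => expR (- x)) kinfty (cvgr_expR (R := R))).
  by apply/funext => t; rewrite /= mulNr.
apply: cvg_trans; apply: near_eq_cvg.
apply: filterS (nbhs_pinfty_ge (num_real 0)) => t t0.
by rewrite [RHS]decay ?Too ?ltry.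
Qed.
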